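(* Let $k$ be a field of characteristic zero and let $A=A_0\oplus A_1\oplus\cdots\oplus A_n$ be a standard graded $k$-algebra. If $A$ is not a principal ideal algebra, then $$\tau(A)=\bigcap_{\varphi}\ker\big(\Omega_{A/k}\to\Omega_{B/k}\big)\neq 0,$$ where the intersection runs over all principal ideal $k$-algebras $B$ and all $k$-algebra homomorphisms $\varphi:A\to B$, and $\Omega_{A/k}\to\Omega_{B/k}$ is the map of Kähler differentials induced by $\varphi$. (That is, $A$ satisfies the Artinian Berger Conjecture.)
   Context: All algebras are commutative, unital and finite dimensional over $k$. A principal ideal algebra is a finite dimensional commutative $k$-algebra in which every ideal is principal. A finite dimensional commutative $k$-algebra $A$ ''satisfies ABC'' if either $A$ is a principal ideal algebra or $\tau(A)\neq 0$. A finite dimensional graded algebra $A=A_0\oplus A_1\oplus\cdots\oplus A_n$ (non-negatively graded, $A_0$ reduced) is called standard if $M=A_1\oplus\cdots\oplus A_n$ is a maximal ideal and $M$ is generated by elements of degree one; equivalently $A\cong F[X_1,\dots,X_m]/I$ with $F$ a finite field extension of $k$ and $I$ homogeneous for the standard grading. *)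

(* Defs.v *)
From HB Require Import structures.
From mathcomp Require Import all_boot all_order all_algebra.
From mathcomp Require Import falgebra.
Set Implicit Arguments. Unset Strict Implicit. Unset Printing Implicit Defensive.
Import Order.TTheory GRing.Theory.
Local Open Scope ring_scope.

#[short(type="comFalgType")]
HB.structure Definition ComFalgebra (R : nzRingType) :=
  { A of Falgebra R A & GRing.ComUnitAlgebra R A }.

Section Defs.
Variable k : fieldType.

Definition is_kalg_hom (A B : comFalgType k) (phi : A -> B) : Prop :=
  [/\ forall x y, phi (x + y) = phi x + phi y,
      forall x y, phi (x * y) = phi x * phi y,
      phi 1 = 1 &
      forall (c : k) x, phi (c *: x) = c *: phi x].

Definition is_ideal (R : comNzRingType) (J : R -> Prop) : Prop :=
  [/\ J 0, forall x y, J x -> J y -> J (x + y) & forall r y, J y -> J (r * y)].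

Definition principal_ideal_algebra (B : comFalgType k) : Prop :=
  forall J : B -> Prop, is_ideal J -> exists g : B, forall x, J x <-> exists r, x = r * g.

Definition standard_graded (A : comFalgType k) (n : nat) (Ad : nat -> {vspace A}) : Prop :=
  let M := (\sum_(1 <= i < n.+1) Ad i)%VS in
  [/\ forall i, (n < i)%N -> Ad i = 0%VS,
      (\sum_(i < n.+1) Ad i)%VS = fullv,
      directv (\sum_(i < n.+1) Ad i),
      1 \in Ad 0%N &
      forall i j x y, x \in Ad i -> y \in Ad j -> x * y \in Ad (i + j)%N] /\
  [/\ forall (x : A) (m : nat), x \in Ad 0%N -> x ^+ m = 0 -> x = 0,
      (M != fullv /\ forall J : A -> Prop, is_ideal J -> (forall x, x \in M -> J x) ->
          (forall x, J x -> x \in M) \/ (forall x, J x)) &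
      M = (fullv * Ad 1%N)%VS].

(* Kaehler differentials Omega_{A/k}: the free A-module on symbols db (b in A)
   modulo the submodule generated by d(x+y)-dx-dy, d(c x) - c dx, d(xy) - x dy - y dx.
   A formal sum  sum_i a_i db_i  is represented by a list of pairs (a_i, b_i). *)
Definition kd_coef (A : comFalgType k) (w : seq (A * A)) (b : A) : A :=
  \sum_(p <- w | p.2 == b) p.1.

Definition kd_gen (A : comFalgType k) (w : seq (A * A)) : Prop :=
  [\/ exists x y : A, w = [:: (1, x + y); (-1, x); (-1, y)],
      exists (c : k) (x : A), w = [:: (1, c *: x); (- c%:A, x)] |
      exists x y : A, w = [:: (1, x * y); (- x, y); (- y, x)]].

Definition kd_zero (A : comFalgType k) (w : seq (A * A)) : Prop :=
  exists s : seq (A * seq (A * A)),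
    (forall p, p \in s -> kd_gen p.2) /\
    forall b, kd_coef w b = \sum_(p <- s) p.1 * kd_coef p.2 b.

Definition kd_map (A B : comFalgType k) (phi : A -> B) (w : seq (A * A)) : seq (B * B) :=
  map (fun p => (phi p.1, phi p.2)) w.

Definition tau_nonzero (A : comFalgType k) : Prop :=
  exists w : seq (A * A), ~ kd_zero w /\
    forall (B : comFalgType k) (phi : A -> B),
      principal_ideal_algebra B -> is_kalg_hom phi -> kd_zero (kd_map phi w).

End Defs.

(* Main.v *)
(* Write [N] for the kernel of the Euler contraction [dx |-> deg x * x] on the
   Kaehler differentials of [A]; it is spanned by the elements [a (x dy - y dx)]
   with [x, y] of degree one. It is non-zero because [A] is not principal, and
   any non-zero [w = a (x dy - y dx)] of maximal degree lies in [tau].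

   Indeed, let [phi : A -> B] with [B] principal and [phi w <> 0]; localize so
   that [B] is local with maximal ideal [t] and [Omega_B] is generated by [dt]
   with [t ^ (e-1) dt = 0]. Let [d] be the least [t]-order of [phi] on degree
   one, and write [phi u = q u * t ^ (i d)] for [u] of degree [i]. If [w] has
   degree [p], then [phi w <> 0] forces [q x dq y - q y dq x] to be non-zero
   modulo the annihilator of [t ^ (p d)], and modulo that annihilator
   [u dv |-> i q u dq v - j q v dq u] (for [i + j = p + 1]) is well defined on
   the differentials of [A] of degree [p + 1]. When [z] has degree one and
   order exactly [d], this functional takes the value
   [(p + 1) (q z) ^ (p-1) (q x dq y - q y dq x) <> 0] on
   [z ^ (p-1) (x dy - y dx)], contradicting the maximality of [p]. *)
Require Import Defs.
From HB Require Import structures.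
From mathcomp Require Import all_boot all_order all_algebra.
From mathcomp Require Import falgebra ring zify.
From Stdlib Require Import Classical.
Set Implicit Arguments. Unset Strict Implicit. Unset Printing Implicit Defensive.
Import GRing.Theory.
Local Open Scope ring_scope.

(** * Kaehler differentials as coefficient functions *)

Section KaehlerForms.
Variables (k : fieldType) (A : comFalgType k).
Implicit Types (f g : A -> A) (a b x y : A) (w : seq (A * A)).

(** [kd_zero w] is convertible to [null_form (kd_coef w)]. With coefficient functions, identities
    between differentials become pointwise [ring] identities. *)
Definition null_form f : Prop :=
  exists s : seq (A * seq (A * A)),
    (forall p, p \in s -> kd_gen p.2) /\
    forall b, f b = \sum_(p <- s) p.1 * kd_coef p.2 b.

Definition dform x b : A := (x == b)%:R.

Lemma kd_coefE w b : kd_coef w b = \sum_(p <- w) p.1 * dform p.2 b.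
Proof.
rewrite /kd_coef big_mkcond; apply: eq_bigr => p _.
by rewrite /dform; case: ifP => _; rewrite ?mulr1 ?mulr0.
Qed.

Lemma null_form_ext f g : (forall b, f b = g b) -> null_form f -> null_form g.
Proof. by move=> fg [s [hs hf]]; exists s; split=> // b; rewrite -fg. Qed.

Lemma null_form0 : null_form (fun=> 0).
Proof. by exists [::]; split=> // b; rewrite big_nil. Qed.

Lemma null_formD f g :
  null_form f -> null_form g -> null_form (fun b => f b + g b).
Proof.
move=> [s [hs hf]] [t [ht hg]]; exists (s ++ t); split=> [p|b].
  by rewrite mem_cat => /orP[/hs|/ht].
by rewrite big_cat hf hg.
Qed.

Lemma null_formZ a f : null_form f -> null_form (fun b => a * f b).
Proof.
move=> [s [hs hf]]; exists [seq (a * p.1, p.2) | p <- s]; split=> [p|b].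
  by move=> /mapP[q /hs hq ->].
by rewrite big_map hf mulr_sumr; apply: eq_bigr => p _; rewrite mulrA.
Qed.

Lemma null_form_gen w : kd_gen w -> null_form (kd_coef w).
Proof.
move=> hw; exists [:: (1, w)]; split=> [p|b]; last by rewrite big_seq1 mul1r.
by rewrite inE => /eqP->.
Qed.

Lemma null_dformD x y : null_form (fun b => dform (x + y) b - dform x b - dform y b).
Proof.
apply: null_form_ext (null_form_gen (Or31 _ _ (ex_intro _ x (ex_intro _ y erefl)))).
by move=> b; rewrite kd_coefE !big_cons big_nil /=; ring.
Qed.

Lemma null_dformZ (c : k) x : null_form (fun b => dform (c *: x) b - c%:A * dform x b).
Proof.
apply: null_form_ext (null_form_gen (Or32 _ _ (ex_intro _ c (ex_intro _ x erefl)))).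
by move=> b; rewrite kd_coefE !big_cons big_nil /=; ring.
Qed.

Lemma null_dformM x y :
  null_form (fun b => dform (x * y) b - x * dform y b - y * dform x b).
Proof.
apply: null_form_ext (null_form_gen (Or33 _ _ (ex_intro _ x (ex_intro _ y erefl)))).
by move=> b; rewrite kd_coefE !big_cons big_nil /=; ring.
Qed.

Lemma null_dform1 : null_form (dform 1).
Proof.
apply: null_form_ext (null_formZ (-1) (null_dformM 1 1)) => b /=.
by rewrite mulr1; ring.
Qed.

Lemma null_dform0 : null_form (dform 0).
Proof.
apply: null_form_ext (null_formZ (-1) (null_dformD 0 0)) => b /=.
by rewrite addr0; ring.
Qed.

Lemma null_dform_horner b (f : {poly k}) :
  null_form (fun x => dform (horner_alg b f) x - horner_alg b f^`() * dform b x).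
Proof.
elim/poly_ind: f => [|f c IH].
  apply: null_form_ext null_dform0 => x.
  by rewrite deriv0 !rmorph0; ring.
have h1 := null_dformD (horner_alg b f * b) (c *: 1).
have h2 := null_dformM (horner_alg b f) b.
have h3 := null_formD (null_dformZ c 1) (null_formZ c%:A null_dform1).
apply: null_form_ext (null_formD (null_formD h1 h2) (null_formD h3 (null_formZ b IH))).
move=> x; rewrite derivD derivM derivC derivX !rmorphD !rmorphM /= rmorph0 rmorph1.
by rewrite !horner_algX horner_algC; ring.
Qed.

(** As a [k]-space the differentials are the tensor square of [A] modulo the relations
    [a d(bc) - ab dc - ac db]; so [beta] need only be bilinear over [k], and Leibniz up to [Q]. *)
Lemma kd_zero_pairing (V : lmodType k) (Q : V -> Prop) (beta : A -> A -> V) :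
  Q 0 -> (forall u v, Q u -> Q v -> Q (u + v)) ->
  (forall b, linear (beta^~ b)) -> (forall a, linear (beta a)) ->
  (forall a b c, Q (beta a (b * c) - beta (a * b) c - beta (a * c) b)) ->
  forall w, kd_zero w -> Q (\sum_(p <- w) beta p.1 p.2).
Proof.
move=> Q0 QD linl linr leib w [s [hs hw]].
have lD b a a' : beta (a + a') b = beta a b + beta a' b.
  by have := linl b 1 a a'; rewrite !scale1r.
have l0 b : beta 0 b = 0 by apply: (addrI (beta 0 b)); rewrite -lD !addr0.
have lZ b c a : beta (c *: a) b = c *: beta a b.
  by have := linl b c a 0; rewrite !addr0 l0 addr0.
have rD a b b' : beta a (b + b') = beta a b + beta a b'.
  by have := linr a 1 b b'; rewrite !scale1r.
have r0 a : beta a 0 = 0 by apply: (addrI (beta a 0)); rewrite -rD !addr0.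
have rZ a c b : beta a (c *: b) = c *: beta a b.
  by have := linr a c b 0; rewrite !addr0 r0 addr0.
have lsum (I : Type) (r : seq I) (F : I -> A) b :
    beta (\sum_(i <- r) F i) b = \sum_(i <- r) beta (F i) b.
  by apply: (big_morph (beta^~ b)) => // x y; apply: lD.
(* [A] may be infinite, so coefficients are summed over the finite list of symbols in use. *)
pose S := undup ([seq p.2 | p <- w] ++ flatten [seq [seq q.2 | q <- p.2] | p <- s]).
have expand a (u : seq (A * A)) : {subset [seq p.2 | p <- u] <= S} ->
    \sum_(b <- S) beta (a * kd_coef u b) b = \sum_(p <- u) beta (a * p.1) p.2.
  move=> sub.
  under eq_bigr do rewrite kd_coefE mulr_sumr lsum.
  rewrite exchange_big /= [LHS]big_seq [RHS]big_seq; apply: eq_bigr => p pu.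
  have pS : p.2 \in S by apply: sub; apply: map_f.
  rewrite (bigD1_seq p.2) ?undup_uniq //= /dform eqxx mulr1 big1 ?addr0 // => b.
  by rewrite eq_sym => /negPf ->; rewrite !mulr0 l0.
have -> : \sum_(p <- w) beta p.1 p.2 = \sum_(p <- s) \sum_(q <- p.2) beta (p.1 * q.1) q.2.
  transitivity (\sum_(b <- S) beta (1 * kd_coef w b) b).
    rewrite expand; first by apply: eq_bigr => p _; rewrite mul1r.
    by move=> b bw; rewrite mem_undup mem_cat bw.
  under eq_bigr do rewrite mul1r hw lsum.
  rewrite exchange_big /= [LHS]big_seq [RHS]big_seq; apply: eq_bigr => p ps.
  rewrite expand // => b bp; rewrite mem_undup mem_cat; apply/orP; right.
  by apply/flattenP; exists [seq q.2 | q <- p.2] => //; apply/mapP; exists p.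
rewrite big_seq; elim/big_ind: _ => // p /hs [] [x [y ->]]; rewrite !big_cons big_nil /= !addr0.
- rewrite rD mulr1 mulrN1 -[- p.1]scaleN1r !lZ !scaleN1r.
  by rewrite addrACA !subrr addr0.
- rewrite mulr1 rZ mulrN -scaleN1r -scalerAr mulr1 !lZ scaleN1r.
  by rewrite addrN.
- rewrite mulr1 !mulrN -[- (p.1 * x)]scaleN1r -[- (p.1 * y)]scaleN1r !lZ !scaleN1r.
  by rewrite addrA.
Qed.

End KaehlerForms.
Lemma ex_least (P : nat -> Prop) :
  (exists n, P n) -> exists n, P n /\ forall m, (m < n)%N -> ~ P m.
Proof.
move=> [n]; have [m] := ubnP n; elim: m n => // m IH n /ltnSE le_nm Pn.
case: (classic (exists2 i, (i < n)%N & P i)) => [[i lt_in Pi]|no].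
  by apply: (IH i) => //; apply: leq_trans le_nm.
by exists n; split=> // i lt_in Pi; apply: no; exists i.
Qed.

(** * Orders along a generator of a maximal ideal *)

Section LocalGenerator.
Variables (R : comNzRingType) (t : R).
Implicit Types (x y r s v : R) (J : R -> Prop).

Definition unit_mod x := exists r s, 1 = r * t + s * x.

(* [t] is a unit or generates a maximal ideal. *)
Definition local_at := forall y, (exists r, y = r * t) \/ unit_mod y.

Lemma unit_modX x m : unit_mod x -> exists r s, 1 = r * t ^+ m + s * x.
Proof.
move=> [r [s E]]; elim: m => [|m [r' [s' E']]].
  by exists 1, 0; rewrite expr0; ring.
exists (r * r'), (r * t * s' + s * (r' * t ^+ m + s' * x)).
rewrite exprS; transitivity ((r * t + s * x) * (r' * t ^+ m + s' * x)).
  by rewrite -E -E' mulr1.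
by ring.
Qed.

Lemma unit_modM x y : unit_mod x -> unit_mod y -> unit_mod (x * y).
Proof.
move=> [r [s E]] [r' [s' E']]; exists (r * (r' * t + s' * y) + s * x * r'), (s * s').
transitivity ((r * t + s * x) * (r' * t + s' * y)); first by rewrite -E -E' mulr1.
by ring.
Qed.

Lemma unit_mod1 : unit_mod 1.
Proof. by exists 0, 1; ring. Qed.

Lemma unit_mod_exp x m : unit_mod x -> unit_mod (x ^+ m).
Proof.
move=> ux; elim: m => [|m IH]; first by rewrite expr0; apply: unit_mod1.
by rewrite exprS; apply: unit_modM.
Qed.

(** An element invertible modulo [t] is invertible modulo [t ^+ e], hence modulo [J]. *)
Lemma unit_mod_cancel J x y e :
  is_ideal J -> J (t ^+ e) -> unit_mod x -> J (x * y) -> J y.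
Proof.
move=> [_ JD JM] Je /(unit_modX e) [r [s E]] Jxy.
have -> : y = (r * y) * t ^+ e + s * (x * y).
  by rewrite -[LHS]mul1r E; ring.
by apply: JD; apply: JM.
Qed.

Hypothesis loc : local_at.

(** The [t]-adic valuation truncated at [e]: divide by [t] until the quotient is invertible modulo
    [t]. *)
Lemma local_valuation e y :
  (exists r, y = r * t ^+ e) \/
  exists i v, [/\ (i < e)%N, y = v * t ^+ i & unit_mod v].
Proof.
elim: e => [|e [[r E]|[i [v [lt_ie E u]]]]].
- by left; exists y; rewrite expr0 mulr1.
- case: (loc r) => [[r' Er]|u]; last by right; exists e, r.
  by left; exists r'; rewrite E Er exprS mulrA.
- by right; exists i, v; split=> //; apply: ltnW.
Qed.

(** Were the order [l] of [y] below [j], then [t ^+ (l + i)] would be a multiple of the next power,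
    against the strict descent below [e]. *)
Lemma local_cancel e i j y r :
    (forall m, (m < e)%N -> ~ exists r, t ^+ m = r * t ^+ m.+1) ->
    (i + j <= e)%N -> y * t ^+ i = r * t ^+ (i + j) ->
  exists s, y = s * t ^+ j.
Proof.
move=> emin le_ije E; case: (local_valuation j y) => // -[l [v [lt_lj Ey [a [b u]]]]].
have lt_lie : (l + i < e)%N by lia.
case: (emin _ lt_lie); exists (a + b * r * t ^+ (j - l.+1)).
have -> : t ^+ (l + i) = a * t ^+ (l + i).+1 + b * (y * t ^+ i).
  by rewrite Ey -[LHS]mul1r u exprS !exprD; ring.
rewrite E mulrDl -[_ * _ * _ * t ^+ (l + i).+1]mulrA -exprD mulrA.
by have -> : (j - l.+1 + (l + i).+1 = i + j)%N by lia.
Qed.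

(** The generator is the least power of [t] in [J]: an element of lower order would put a smaller
    power there. *)
Lemma local_nilpotent_principal e J :
  t ^+ e = 0 -> is_ideal J -> exists g, forall x, J x <-> exists r, x = r * g.
Proof.
move=> te0 idJ; have [J0 JD JM] := idJ.
have Je : J (t ^+ e) by rewrite te0.
have [i [Ji imin]] := ex_least (ex_intro (fun i => J (t ^+ i)) e Je).
exists (t ^+ i) => x; split=> [Jx|[r ->]]; last exact: JM.
case: (local_valuation i x) => // -[l [v [lt_li Ex u]]].
by case: (imin l lt_li); apply: (unit_mod_cancel idJ Je u); rewrite -Ex.
Qed.

End LocalGenerator.

(** * Annihilating polynomials, maximal ideals and local factors *)

Section AnnihilatingPolynomials.
Variables (k : fieldType) (A : comFalgType k).

Lemma annihilating_poly (b : A) : exists2 f : {poly k}, f != 0 & horner_alg b f = 0.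
Proof.
pose N := \dim (fullv : {vspace A}).
pose X := [tuple b ^+ i | i < N.+1].
have notfree : ~~ free X.
  apply/negP => /eqP fr.
  have : (\dim <<X>> <= N)%N by apply: dimvS; apply: subvf.
  by rewrite fr size_tuple ltnn.
have [c cE cN0] : exists2 c : 'I_N.+1 -> k, \sum_i c i *: b ^+ i = 0 & exists i, c i != 0.
  apply: NNPP => no; case/negP: notfree; apply/freeP => c cE i.
  apply: NNPP => /eqP ci; apply: no; exists c; last by exists i.
  by rewrite -[RHS]cE; apply: eq_bigr => j _; rewrite -tnth_nth tnth_mktuple.
case: cN0 => i ci; exists (\sum_(j < N.+1) c j *: 'X^j).
  apply: contra_neq ci => /(congr1 (fun f : {poly k} => f`_i)).
  rewrite coef0 coef_sum (bigD1 i) //= coefZ coefXn eqxx mulr1 big1 ?addr0 // => j ji.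
  by rewrite coefZ coefXn eq_sym (negPf (ji : val j != val i)) mulr0.
rewrite rmorph_sum -[RHS]cE; apply: eq_bigr => j _.
by rewrite /= linearZ rmorphXn /= horner_algX mulr_algl.
Qed.

(** Starting from an annihilating polynomial, differentiate as long as the value at [b] stays in
    [I]. In characteristic zero only constants have zero derivative, and a non-zero constant in [I]
    would put [1] there. This stands in for separability of residue fields. *)
Lemma separable_mod (Hchar : [pchar k] =i pred0) (I : A -> Prop) (b : A) :
    (forall (c : k) x, I x -> I (c *: x)) -> I 0 -> ~ I 1 ->
  exists f : {poly k}, I (horner_alg b f) /\ ~ I (horner_alg b f^`()).
Proof.
move=> IZ I0 I1.
have [f fN0 fb] := annihilating_poly b.
have If : I (horner_alg b f) by rewrite fb.
have [m] := ubnP (size f); elim: m f fN0 If {fb} => // m IH f fN0 If /ltnSE le_fm.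
case: (classic (I (horner_alg b f^`()))) => [If'|]; last by exists f.
apply: (IH f^`()) => //; last first.
  exact: leq_trans (lt_size_deriv fN0) le_fm.
apply/eqP => f'0.
have sf : (size f <= 1)%N.
  apply/leq_sizeP => -[|j] // _.
  have := congr1 (fun g : {poly k} => g`_j) f'0.
  rewrite coef_deriv coef0 -mulr_natr => /eqP.
  by rewrite mulf_eq0 (proj1 (pcharf0P k) Hchar) orbF => /eqP.
have fC := size1_polyC sf.
have f0 : f`_0 != 0 by apply: contra_neq fN0 => f0; rewrite fC f0.
apply: I1; have := IZ (f`_0)^-1 _ If.
by rewrite fC horner_algC coefC eqxx scalerA mulVf // scale1r.
Qed.

(** Factor the powers of [X] out of an annihilating polynomial and solve for the lowest term. *)
Lemma power_stabilizes (t : A) : exists e r, t ^+ e = r * t ^+ e.+1.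
Proof.
have [f fN0 fb] := annihilating_poly t.
have {fb} : t ^+ 0 * horner_alg t f = 0 by rewrite fb mulr0.
elim/poly_ind: f 0%N fN0 => [|f c IH] m; first by rewrite eqxx.
rewrite rmorphD rmorphM /= horner_algX horner_algC => fcN0 E.
have [c0|cN0] := eqVneq c 0; last first.
  exists m, (- (c^-1 *: horner_alg t f)).
  have /eqP : c^-1 *: (t ^+ m * (horner_alg t f * t + c%:A)) = 0 by rewrite E scaler0.
  rewrite mulrDr -scalerAr mulr1 scalerDr scalerA mulVf // scale1r.
  rewrite addrC addr_eq0 => /eqP ->.
  by rewrite exprS mulNr -!scalerAl; congr (- (_ *: _)); ring.
apply: (IH m.+1); last by rewrite -E c0 scale0r exprS; ring.
by apply: contra_neq fcN0 => ->; rewrite c0 mul0r add0r.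
Qed.

(** If the ideal of [g] is not maximal, some [y] enlarges it to a proper ideal, again principal; its
    dimension grows, so this ends. *)
Lemma maximal_above (g : A) :
    principal_ideal_algebra A -> ~ (exists r, 1 = r * g) ->
  exists t, [/\ local_at t, ~ (exists r, 1 = r * t) & exists r, g = r * t].
Proof.
move=> pia; have [m] := ubnP (\dim (fullv : {vspace A}) - \dim (limg (amulr g))).
elim: m g => // m IH g /ltnSE le_m gN1.
case: (classic (local_at g)) => [loc|nloc].
  by exists g; split=> //; exists 1; rewrite mul1r.
have [y yg yu] : exists2 y, ~ (exists r, y = r * g) & ~ unit_mod g y.
  apply: NNPP => no; apply: nloc => y.
  case: (classic (exists r, y = r * g)) => [|yg]; first by left.
  by right; apply: NNPP => yu; apply: no; exists y.
have [] := pia (fun x => exists r s, x = r * g + s * y).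
  split; first by exists 0, 0; ring.
    by move=> _ _ [r [s ->]] [r' [s' ->]]; exists (r + r'), (s + s'); ring.
  by move=> c _ [r [s ->]]; exists (c * r), (c * s); ring.
move=> h hP.
have [c gh] : exists c, g = c * h by apply/hP; exists 1, 0; ring.
have [c' yh] : exists c', y = c' * h by apply/hP; exists 0, 1; ring.
have hN1 : ~ exists r, 1 = r * h by move=> /hP [r [s E]]; apply: yu; exists r, s.
have [||t [loc tN1 [r hr]]] // := IH h; last first.
  by exists t; split=> //; exists (c * r); rewrite gh hr mulrA.
have lt_dim : (\dim (limg (amulr g)) < \dim (limg (amulr h)))%N.
  rewrite ltnNge; apply/negP => le_dim.
  have sub : (limg (amulr g) <= limg (amulr h))%VS.
    apply/subvP => _ /memv_imgP[u _ ->]; apply/memv_imgP; exists (u * c); rewrite ?memvf //.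
    by rewrite !lfunE /= gh mulrA.
  have /eqP eqgh : limg (amulr g) == limg (amulr h) by rewrite eqEdim sub.
  have : y \in limg (amulr h).
    by apply/memv_imgP; exists c'; rewrite ?memvf // lfunE.
  by rewrite -eqgh => /memv_imgP[u _]; rewrite lfunE /= => yu'; apply: yg; exists u.
apply: leq_trans le_m; apply: ltn_sub2l => //.
by apply: leq_trans lt_dim _; apply: dimvS; apply: subvf.
Qed.

(* [eta] is the idempotent cutting out the local factor at [t]. *)
Lemma local_factor (t : A) : ~ (exists r, 1 = r * t) ->
  exists e eta c, [/\ (0 < e)%N, eta * t ^+ e = 0, 1 = c * t ^+ e + eta &
    forall m, (m < e)%N -> ~ exists r, t ^+ m = r * t ^+ m.+1].
Proof.
move=> tN1.
have [e [[r E] emin]] := ex_least (power_stabilizes t).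
have Ej j : t ^+ e = r ^+ j * t ^+ (e + j).
  elim: j => [|j IH]; first by rewrite addn0 mul1r.
  rewrite {1}IH exprD {1}E (exprSr r) addnS -addSn exprD; ring.
(* Since [t ^+ e = r ^+ e * t ^+ (e + e)], the element [r ^+ e * t ^+ e] is idempotent and its
   complement kills [t ^+ e]. *)
exists e, (1 - r ^+ e * t ^+ e), (r ^+ e); split=> //.
- case: e {emin Ej} E => // E; case: tN1; exists r.
  by move: E; rewrite expr0 expr1.
- by rewrite mulrBl mul1r -mulrA -exprD -Ej subrr.
- by ring.
Qed.

End AnnihilatingPolynomials.

(** * Differentials of a principal ideal algebra at one maximal ideal *)

Lemma lfun_of_linear (k : fieldType) (U V : vectType k) (f : U -> V) :
  linear f -> exists F : 'Hom(U, V), forall x, F x = f x.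
Proof.
move=> lin; pose f_lin := GRing.isLinear.Build k U V *:%R f lin.
pose g : {linear U -> V} := HB.pack f f_lin.
by exists (linfun g) => x; rewrite lfunE.
Qed.

Lemma is_idealB (R : comNzRingType) (J : R -> Prop) :
  is_ideal J -> forall x y, J x -> J y -> J (x - y).
Proof. by move=> [_ JD JM] x y Jx Jy; apply: JD => //; rewrite -mulN1r; apply: JM. Qed.

Lemma is_idealZ (k : fieldType) (A : comFalgType k) (J : A -> Prop) :
  is_ideal J -> forall (c : k) x, J x -> J (c *: x).
Proof. by move=> [_ _ JM] c x Jx; rewrite -mulr_algl; apply: JM. Qed.

Lemma is_ideal_natr (k : fieldType) (Hchar : [pchar k] =i pred0)
    (A : comFalgType k) (J : A -> Prop) (n : nat) x :
  is_ideal J -> (0 < n)%N -> J (n%:R * x) -> J x.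
Proof.
move=> idJ n0 /(is_idealZ idJ n%:R^-1).
rewrite mulr_natl -scaler_nat scalerA mulVf ?scale1r //.
by rewrite (proj1 (pcharf0P k) Hchar) -lt0n.
Qed.

Lemma null_form_sum (k : fieldType) (A : comFalgType k) (I : Type) (r : seq I)
    (F : I -> A -> A) :
  (forall i, null_form (F i)) -> null_form (fun b => \sum_(i <- r) F i b).
Proof.
move=> nF; elim: r => [|i r IH].
  by apply: null_form_ext (null_form0 A) => b; rewrite big_nil.
by apply: null_form_ext (null_formD (nF i) IH) => b; rewrite big_cons.
Qed.

(* Localizing at a maximal ideal [t], the Kaehler differentials of a principal
   ideal algebra are generated by [dt], whose annihilator [J] contains
   [t ^+ e.-1]; [D b] is a coefficient of [db]. Choosing [t] above the
   annihilator of [w] keeps [w] non-zero. *)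
Lemma local_differential (k : fieldType) (Hchar : [pchar k] =i pred0)
    (B : comFalgType k) (w : seq (B * B)) :
  principal_ideal_algebra B -> ~ kd_zero w ->
  exists t e (D : 'End(B)) (J : B -> Prop),
  [/\ local_at t, (0 < e)%N &
      forall m, (m < e)%N -> ~ exists r, t ^+ m = r * t ^+ m.+1] /\
  [/\ is_ideal J, J (t ^+ e.-1),
      forall x y, J (D (x * y) - x * D y - y * D x),
      forall a b, null_form (fun x => a * dform b x) -> J (a * D b) &
      ~ J (\sum_(p <- w) p.1 * D p.2)].
Proof.
move=> pia wN0.
(* The annihilator of [w] is principal and, as [w] is non-zero, proper; [t] is taken above its
   generator. *)
have [] := pia (fun a => null_form (fun b => a * kd_coef w b)).
  split.
  - by apply: null_form_ext (null_form0 B) => b; rewrite mul0r.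
  - by move=> x y hx hy; apply: null_form_ext (null_formD hx hy) => b; rewrite mulrDl.
  - by move=> r y hy; apply: null_form_ext (null_formZ r hy) => b; rewrite mulrA.
move=> g gP.
have gN1 : ~ exists r, 1 = r * g.
  by move=> /gP h; apply: wN0; apply: null_form_ext h => b; rewrite mul1r.
have [t [loc tN1 [c gE]]] := maximal_above pia gN1.
have [e [eta [c1 [e0 etat E1 emin]]]] := local_factor tN1.
have eta2 : eta * eta = eta.
  rewrite -[RHS]mulr1 [in RHS]E1 mulrDr mulrCA etat mulr0 add0r //.
(* [P b g] reads [eta db = eta g dt]. The next claim reaches it at [j = e], removing one factor [t]
   at a time. *)
pose P b g := null_form (fun x => eta * dform b x - eta * g * dform t x).
have Pj j b : (j <= e)%N ->
    exists g, null_form (fun x => t ^+ (e - j) * eta * (dform b x - g * dform t x)).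
  elim: j b => [|j IH] b lt_je.
    exists 0; apply: null_form_ext (null_form0 B) => x.
    by rewrite subn0 [_ * eta]mulrC etat mul0r.
  have [|||/= f [[c' fb] f'b]] := @separable_mod _ B Hchar (fun y => exists r, y = r * t) b.
  - by move=> a _ [r ->]; exists (a *: r); rewrite scalerAl.
  - by exists 0; rewrite mul0r.
  - exact: tN1.
  case: (loc (horner_alg b f^`())) => // -[r [s Ers]].
  have [gb Hb] := IH b (ltnW lt_je).
  have [gc Hc] := IH c' (ltnW lt_je).
  have N1 := null_dform_horner b f; have N2 := null_dformM c' t; rewrite -fb in N2.
  (* From [f(b) = c' t] and [1 = r t + s f'(b)] follows [db = r t db + s c' dt + s t dc']; the terms
     with a factor [t] are known by induction. *)
  exists (t * (r * gb + s * gc) + s * c').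
  apply: null_form_ext (null_formD (null_formD (null_formZ r Hb) (null_formZ s Hc))
    (null_formD (null_formZ (s * t ^+ (e - j.+1) * eta) N2)
                (null_formZ (- (s * t ^+ (e - j.+1) * eta)) N1))) => x.
  have -> : (e - j = (e - j.+1).+1)%N by lia.
  rewrite -[dform b x in RHS]mul1r Ers exprS; ring.
have PE b : exists g, P b g.
  have [g' h] := Pj e b (leqnn e); exists g'; apply: null_form_ext h => x.
  by rewrite subnn expr0; ring.
have PD b b' g1 g2 : P b g1 -> P b' g2 -> P (b + b') (g1 + g2).
  move=> h h'.
  apply: null_form_ext (null_formD (null_formD h h') (null_formZ eta (null_dformD b b'))).
  by move=> x; ring.
have PZ (a : k) b g' : P b g' -> P (a *: b) (a *: g').
  move=> h.
  apply: null_form_ext (null_formD (null_formZ a%:A h) (null_formZ eta (null_dformZ a b))).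
  by move=> x; rewrite -[a *: g']mulr_algl; ring.
have P0 : P 0 0.
  by apply: null_form_ext (null_formZ eta (null_dform0 B)) => x; ring.
(* Coefficients of [dt] are not unique; choosing them on a basis makes [D] linear. *)
pose X := vbasis (fullv : {vspace B}).
have [G GP] := fin_all_exists (fun i : 'I_(\dim (fullv : {vspace B})) => PE X`_i).
have [] := @lfun_of_linear _ B B (fun b => \sum_i coord X i b *: G i).
  move=> a x y; rewrite scaler_sumr -big_split; apply: eq_bigr => i _.
  by rewrite linearP /= scalerDl scalerA.
move=> D DE.
have DP b : P b (D b).
  rewrite DE {1}(coord_vbasis (memvf b)).
  by elim/big_ind2: _ => // [b1 g1 b2 g2 h1 h2|i _]; [apply: PD | apply: PZ].
have idJ : is_ideal (fun y => null_form (fun x => eta * y * dform t x)).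
  split.
  - by apply: null_form_ext (null_form0 B) => x; ring.
  - by move=> x y hx hy; apply: null_form_ext (null_formD hx hy) => b; ring.
  - by move=> r y hy; apply: null_form_ext (null_formZ r hy) => b; ring.
exists t, e, D, (fun y => null_form (fun x => eta * y * dform t x)).
split; split=> //.
(* Multiply [d(eta t^e) = 0] by [eta]: the term in [d eta] dies, leaving [e eta t^(e-1) dt = 0]. *)
- have h1 := null_dform_horner t 'X^e; have h2 := null_dformM eta (t ^+ e).
  rewrite derivXn rmorphMn !rmorphXn /= horner_algX -mulr_natl in h1.
  rewrite etat in h2.
  apply: (is_ideal_natr Hchar idJ e0) => /=.
  apply: null_form_ext (null_formD (null_formZ eta (null_dform0 B))
    (null_formD (null_formZ (- eta) h1) (null_formZ (- eta) h2))) => x /=.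
  transitivity (eta * (e%:R * t ^+ e.-1) * dform t x
    + (eta * eta - eta) * dform (t ^+ e) x + eta * t ^+ e * dform eta x); first by ring.
  by rewrite eta2 etat; ring.
- move=> x y.
  apply: null_form_ext (null_formD (null_formD (null_formZ (-1) (DP (x * y)))
    (null_formZ eta (null_dformM x y))) (null_formD (null_formZ x (DP y)) (null_formZ y (DP x)))).
  by move=> b; ring.
- move=> a b h.
  apply: null_form_ext (null_formD (null_formZ eta h) (null_formZ (- a) (DP b))) => x.
  by ring.
(* Otherwise [eta] annihilates [w], so it is a multiple of [g], hence of [t]; then so is
   [1 = c1 * t ^+ e + eta], as [e] is positive. *)
move=> h.
have [] : exists r, eta = r * g.
  apply/gP.
  apply: null_form_ext (null_formD h
    (null_form_sum w (fun p : B * B => null_formZ p.1 (DP p.2)))) => x /=.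
  rewrite kd_coefE !mulr_sumr mulr_suml -big_split /=.
  by apply: eq_bigr => p _; ring.
move=> r etaE; apply: tN1; exists (c1 * t ^+ e.-1 + r * c).
by rewrite mulrDl -!mulrA -gE -etaE -exprSr prednK.
Qed.

(** * Structure of a standard graded algebra *)

Section GradedAlgebra.
Variables (k : fieldType) (A : comFalgType k) (n : nat) (Ad : nat -> {vspace A}).

Definition projections (pr : nat -> 'End(A)) :=
  [/\ forall i a, pr i a \in Ad i,
      forall i a, a \in Ad i -> pr i a = a,
      forall i j a, a \in Ad j -> i != j -> pr i a = 0 &
      forall a, a = \sum_(i < n.+1) pr i a].

Lemma graded_projections : standard_graded n Ad -> exists pr, projections pr.
Proof.
move=> [[Adn Adsum Addir _ _] _].
pose V := (\sum_(i < n.+1) Ad i)%VS.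
pose p (i : 'I_n.+1) : 'End(A) := sumv_pi_for (erefl V) i.
have p_mem i a : p i a \in Ad i by apply: memv_sum_pi.
have p_sum a : \sum_i p i a = a by apply: sumv_pi_sum; rewrite /V Adsum memvf.
have p_hom i (j : 'I_n.+1) a : a \in Ad j -> p i a = if i == j then a else 0.
  move=> aj; have /directv_sum_unique uniq_sum := Addir.
  have v_mem (l : 'I_n.+1) : true -> (if l == j then a else 0) \in Ad l.
    by case: eqP => [->|_] // _; apply: mem0v.
  have : \sum_l p l a == \sum_l (if l == j then a else 0).
    by rewrite p_sum -big_mkcond big_pred1_eq.
  by rewrite (uniq_sum _ _ (fun l _ => p_mem l a) v_mem) => /forall_inP/(_ i isT)/eqP.
exists (fun i => if insub i is Some j then p j else 0); split.
- move=> i a; case: insubP => [j _ <-|_]; first exact: p_mem.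
  by rewrite lfunE mem0v.
- move=> i a ai; case: insubP => [j _ ij|].
    by rewrite (p_hom j j) ?eqxx // ij.
  rewrite -leqNgt => /Adn Adi0; move: ai; rewrite Adi0 memv0 => /eqP ->.
  by rewrite linear0.
- move=> i j a aj ij; case: insubP => [i' _ ii'|]; last by rewrite lfunE.
  have [lt_nj|le_jn] := ltnP n j.
    by move: aj; rewrite Adn // memv0 => /eqP ->; rewrite linear0.
  rewrite (p_hom i' (Ordinal (le_jn : j < n.+1)%N)) // ifN //.
  by apply: contraNneq ij => ij; rewrite -ii' ij.
- move=> a; rewrite -[LHS]p_sum; apply: eq_bigr => i _.
  by rewrite valK.
Qed.

Variable pr : nat -> 'End(A).
Hypotheses (sg : standard_graded n Ad) (prP : projections pr).

Lemma homogeneous_ind (P : A -> Prop) :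
  P 0 -> (forall x y, P x -> P y -> P (x + y)) ->
  (forall i x, x \in Ad i -> P x) -> forall a, P a.
Proof.
have [pr_mem _ _ pr_sum] := prP.
by move=> P0 PD Ph a; rewrite (pr_sum a); elim/big_ind: _ => // i _; apply: Ph.
Qed.

Lemma graded_exp z m : z \in Ad 1%N -> z ^+ m \in Ad m.
Proof.
have [[_ _ _ Ad1 AdM] _] := sg.
by move=> z1; elim: m => [|m IH]; rewrite ?expr0 // exprS; apply: (AdM 1%N m).
Qed.

Lemma prM m a b : pr m (a * b) = \sum_(i < m.+1) pr i a * pr (m - i)%N b.
Proof.
have [_ pr_id pr_ne _] := prP; have [[_ _ _ _ AdM] _] := sg.
elim/homogeneous_ind: a => [|x y hx hy|i a ai].
- by rewrite mul0r linear0 big1 // => i _; rewrite linear0 mul0r.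
- rewrite mulrDl linearD /= hx hy -big_split; apply: eq_bigr => i _ /=.
  by rewrite linearD mulrDl.
elim/homogeneous_ind: b => [|x y hx hy|j b bj].
- by rewrite mulr0 linear0 big1 // => l _; rewrite linear0 mulr0.
- rewrite mulrDr linearD /= hx hy -big_split; apply: eq_bigr => l _ /=.
  by rewrite linearD mulrDr.
have [<-|ijm] := eqVneq (i + j)%N m.
  have lt_i : (i < (i + j).+1)%N by rewrite ltnS leq_addr.
  rewrite (pr_id _ _ (AdM _ _ _ _ ai bj)) (bigD1 (Ordinal lt_i)) //= big1 ?addr0.
    by rewrite addKn !pr_id.
  move=> l li; rewrite (pr_ne _ i) ?mul0r //.
rewrite (pr_ne _ (i + j)%N) ?AdM 1?eq_sym // big1 // => l _.
have [li|li] := eqVneq (l : nat) i; last by rewrite (pr_ne _ i) ?mul0r.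
rewrite (pr_ne (m - l)%N j) ?mulr0 //; apply: contraNneq ijm => <-.
by rewrite -li subnKC // -ltnS.
Qed.

Lemma prS_mul1 i u v : v \in Ad 1%N -> pr i.+1 (u * v) = pr i u * v.
Proof.
have [_ pr_id pr_ne _] := prP; move=> v1.
rewrite prM !big_ord_recr /= subnn subSnn (pr_id _ _ v1) (pr_ne 0%N 1%N v) //.
rewrite mulr0 addr0 big1 ?add0r // => l _.
by rewrite (pr_ne _ 1%N v) ?mulr0 //; have := ltn_ord l; lia.
Qed.

Lemma graded_local y :
  y \in (fullv * Ad 1%N)%VS \/ exists r m, m \in (fullv * Ad 1%N)%VS /\ 1 = r * y + m.
Proof.
have [_ [_ [_ Mmax] <-]] := sg.
set M := (\sum_(1 <= i < n.+1) Ad i)%VS.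
have MM r x : x \in M -> r * x \in M.
  have -> : M = (fullv * Ad 1%N)%VS by have [_ [_ _ <-]] := sg.
  move=> xM; have := memv_mul (memvf r) xM.
  by rewrite prodvA; apply: subvP; apply: prodvSl; apply: subvf.
have [] := Mmax (fun x => exists r m, m \in M /\ x = r * y + m).
- split.
  + by exists 0, 0; split; [apply: mem0v | ring].
  + move=> _ _ [r [m [hm ->]]] [r' [m' [hm' ->]]]; exists (r + r'), (m + m').
    by split; [apply: memvD | ring].
  + move=> c _ [r [m [hm ->]]]; exists (c * r), (c * m).
    by split; [apply: MM | ring].
- by move=> x xM; exists 0, x; split=> //; ring.
- by move=> h; left; apply: h; exists 1, 0; split; [apply: mem0v | ring].
- by move=> h; right; have [r [m [hm E]]] := h 1; exists r, m.
Qed.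

Lemma pr0_gen a : a \in (fullv * Ad 1%N)%VS -> pr 0 a = 0.
Proof.
have [_ _ pr_ne _] := prP.
suff sub : (fullv * Ad 1%N <= lker (pr 0))%VS by move=> /(subvP sub); rewrite memv_ker => /eqP.
apply/prodvP => u v _ v1; rewrite memv_ker prM big_ord1 /= subnn.
by rewrite (pr_ne 0%N 1%N v) // mulr0.
Qed.

Lemma pr_genS i a : pr i.+1 a \in (fullv * Ad 1%N)%VS.
Proof.
have [pr_mem _ _ _] := prP; have [[Adn _ _ _ _] [_ _ <-]] := sg.
have := pr_mem i.+1 a; have [lt_ni|le_in] := ltnP n i.+1.
  by rewrite Adn // memv0 => /eqP ->; apply: mem0v.
apply: subvP; rewrite (bigD1_seq i.+1) ?iota_uniq ?mem_index_iota //=.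
  exact: addvSl.
Qed.

(** [Ad 0] meets the maximal ideal trivially, so [a] is invertible modulo it; take components of
    degree zero. Thus [Ad 0] is a field. *)
Lemma graded0_inv a : a \in Ad 0%N -> a != 0 -> exists2 b, b \in Ad 0%N & b * a = 1.
Proof.
have [pr_mem pr_id _ _] := prP; have [[_ _ _ Ad1 _] _] := sg.
move=> a0 aN0; case: (graded_local a) => [aM|[r [m [mM E]]]].
  by move: aN0; rewrite -(pr_id _ _ a0) pr0_gen ?eqxx.
exists (pr 0 r); first exact: pr_mem.
rewrite -[RHS](pr_id _ _ Ad1) E linearD /= (pr0_gen mM) addr0 prM big_ord1 /= subnn.
by rewrite [pr 0 a]pr_id.
Qed.

(** The maximal ideal is generated by [x], which is nilpotent because [x ^+ n.+1] has degree above
    [n]. *)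
Lemma graded1_principal x :
  x \in Ad 1%N -> (forall y, y \in Ad 1%N -> exists2 c, c \in Ad 0%N & y = c * x) ->
  principal_ideal_algebra A.
Proof.
move=> x1 gen; have [[Adn _ _ _ _] _] := sg.
have xn : x ^+ n.+1 = 0.
  by have := graded_exp n.+1 x1; rewrite Adn // memv0 => /eqP.
have genM y : y \in (fullv * Ad 1%N)%VS -> exists r, y = r * x.
  suff sub : (fullv * Ad 1%N <= limg (amulr x))%VS.
    by move=> /(subvP sub)/memv_imgP[r _]; rewrite lfunE /= => ->; exists r.
  apply/prodvP => u v _ /gen[c _ ->]; apply/memv_imgP; exists (u * c); rewrite ?memvf //.
  by rewrite lfunE /= mulrA.
move=> J; apply: (@local_nilpotent_principal A x _ n.+1) => //.
move=> y; case: (graded_local y) => [/genM|[r [m [/genM [s ->] E]]]]; first by left.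
by right; exists s, r; rewrite [LHS]E addrC.
Qed.

(** Linear algebra over the field [Ad 0], done with [k]-subspaces stable under it: a stable [H]
    maximal among those containing [x] but not [y] cuts out the kernel of [f] in degree one. *)
Lemma graded1_functional x y :
    x \in Ad 1%N -> y \in Ad 1%N -> x != 0 ->
    ~ (exists2 c, c \in Ad 0%N & y = c * x) ->
  exists f : 'End(A), [/\ f x = 0, f y = 1 &
    forall c a, c \in Ad 0%N -> a \in Ad 1%N -> f (c * a) = c * f a].
Proof.
move=> x1 y1 xN0 yx; have [[_ _ _ Ad1 AdM] _] := sg.
have A00 c c' : c \in Ad 0%N -> c' \in Ad 0%N -> c * c' \in Ad 0%N by apply: (AdM 0%N 0%N).
pose stable (H : {vspace A}) := forall c h, c \in Ad 0%N -> h \in H -> c * h \in H.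
have stable_line z : stable (Ad 0%N * <[z]>)%VS.
  move=> c h c0; rewrite -limg_amulr => /memv_imgP[u u0 ->].
  by rewrite !lfunE /= mulrA; apply/memv_imgP; exists (c * u); rewrite ?A00 // lfunE.
have line z a : reflect (exists2 c, c \in Ad 0%N & a = c * z) (a \in (Ad 0%N * <[z]>)%VS).
  rewrite -limg_amulr; apply: (iffP memv_imgP) => -[c c0 ->]; exists c => //; by rewrite lfunE.
have [H [Hst xH yH Hmax]] : exists H : {vspace A}, [/\ stable H, x \in H, y \notin H &
    forall z, z \notin H -> y \in (H + Ad 0%N * <[z]>)%VS].
  have : exists H : {vspace A}, [/\ stable H, x \in H & y \notin H].
    exists (Ad 0%N * <[x]>)%VS; split => //.
      by apply/line; exists 1; rewrite ?mul1r.
    by apply/negP => /line.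
  move=> [H]; have [m] := ubnP (\dim (fullv : {vspace A}) - \dim H).
  elim: m H => // m IH H /ltnSE le_m [Hst xH yH].
  case: (classic (forall z, z \notin H -> y \in (H + Ad 0%N * <[z]>)%VS)) => [h|].
    by exists H.
  move=> nmax; have [z zH /negP yHz] : exists2 z, z \notin H & ~ y \in (H + Ad 0%N * <[z]>)%VS.
    by apply: NNPP => no; apply: nmax => z zH; apply: NNPP => yHz; apply: no; exists z.
  apply: (IH (H + Ad 0%N * <[z]>)%VS); last first.
    split; last 1 first.
    - exact: yHz.
    - move=> c h c0 /memv_addP[u uH [v vz ->]]; rewrite mulrDr.
      by apply: memv_add; [apply: Hst | apply: stable_line].
    - exact: subvP (addvSl _ _) _ xH.
  have lt_dim : (\dim H < \dim (H + Ad 0%N * <[z]>)%VS)%N.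
    rewrite ltnNge; apply/negP => le_dim; case/negP: zH.
    have /eqP -> : H == (H + Ad 0%N * <[z]>)%VS by rewrite eqEdim addvSl.
    by apply: (subvP (addvSr _ _)); apply/line; exists 1; rewrite ?mul1r.
  apply: leq_trans le_m; apply: ltn_sub2l => //.
  by apply: leq_trans lt_dim _; apply: dimvS; apply: subvf.
(* [f a] will be the unique [c] with [a - c * y] in [H]. *)
have decomp a : a \in Ad 1%N -> exists2 c, c \in Ad 0%N & a - c * y \in H.
  move=> a1; have [aH|aH] := boolP (a \in H).
    by exists 0; rewrite ?mem0v // mul0r subr0.
  have /memv_addP[h hH [_ /line[c c0 ->] yE]] := Hmax a aH.
  have cN0 : c != 0 by apply: contraNneq yH => c00; rewrite yE c00 mul0r addr0.
  have [c' c'0 c'c] := graded0_inv c0 cN0.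
  exists c' => //; rewrite yE mulrDr mulrA c'c mul1r opprD addrCA subrr addr0.
  by rewrite memvN; apply: Hst.
have uniq_c a c c' : c \in Ad 0%N -> c' \in Ad 0%N ->
    a - c * y \in H -> a - c' * y \in H -> c = c'.
  move=> c0 c'0 hc hc'; apply/eqP; rewrite -subr_eq0; apply: contraNT yH => cc'.
  have [b b0 bE] := graded0_inv (memvB c0 c'0) cc'.
  rewrite -[y]mul1r -bE -mulrA; apply: Hst => //.
  have -> : (c - c') * y = (a - c' * y) - (a - c * y) by ring.
  exact: memvB.
pose X := vbasis (Ad 1%N).
have Xdecomp (i : 'I_(\dim (Ad 1%N))) : exists c, c \in Ad 0%N /\ X`_i - c * y \in H.
  have [|c c0 cH] := decomp X`_i; last by exists c.
  by apply: vbasis_mem; apply: mem_nth; rewrite size_tuple.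
have [G GP] := fin_all_exists Xdecomp.
have [] := @lfun_of_linear _ A A (fun b => \sum_i coord X i b *: G i).
  move=> a u v; rewrite scaler_sumr -big_split; apply: eq_bigr => i _.
  by rewrite linearP /= scalerDl scalerA.
move=> f fE.
have f0 a : f a \in Ad 0%N.
  by rewrite fE; apply: memv_suml => i _; apply: memvZ; case: (GP i).
have fH a : a \in Ad 1%N -> a - f a * y \in H.
  move=> a1; rewrite fE {1}(coord_vbasis a1) mulr_suml -sumrB.
  apply: memv_suml => i _; rewrite -scalerAl -scalerBr; apply: memvZ.
  by case: (GP i).
exists f; split.
- by apply: (@uniq_c x); rewrite ?mem0v ?mul0r ?subr0 ?fH.
- by apply: (@uniq_c y); rewrite ?mul1r ?subrr ?mem0v ?fH.
- move=> c a c0 a1; apply: (@uniq_c (c * a)); rewrite ?A00 ?fH ?(AdM 0%N 1%N) //.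
  by rewrite -mulrA -mulrBr; apply: Hst; rewrite ?fH.
Qed.

(* [a (x dy - y dx)] *)
Definition koszul (a x y : A) : seq (A * A) := [:: (a * x, y); (- (a * y), x)].

Lemma koszul_neq0 (Hchar : [pchar k] =i pred0) : ~ principal_ideal_algebra A ->
  exists x y, [/\ x \in Ad 1%N, y \in Ad 1%N & ~ kd_zero (koszul 1 x y)].
Proof.
move=> npia; have [pr_mem pr_id _ _] := prP.
have [x [y [x1 y1 xN0 yx]]] : exists x y, [/\ x \in Ad 1%N, y \in Ad 1%N, x != 0 &
    ~ exists2 c, c \in Ad 0%N & y = c * x].
  apply: NNPP => no.
  have gen x : x \in Ad 1%N -> x != 0 ->
      forall y, y \in Ad 1%N -> exists2 c, c \in Ad 0%N & y = c * x.
    by move=> x1 xN0 y y1; apply: NNPP => h; apply: no; exists x, y.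
  apply: npia; case: (classic (exists2 x, x \in Ad 1%N & x != 0)) => [[x x1 xN0]|Ad10].
    exact: graded1_principal (gen x x1 xN0).
  apply: (@graded1_principal 0); first exact: mem0v.
  move=> y y1; exists 0; first exact: mem0v.
  by rewrite mulr0; apply: NNPP => /eqP yN0; apply: Ad10; exists y.
exists x, y; split=> // kz.
have [f [fx fy fM]] := graded1_functional x1 y1 xN0 yx.
(* Only components of degree one count. This pairing sends [x dy - y dx] to [2 x], which is non-zero
   in characteristic zero. *)
pose beta a b := pr 1 a * f (pr 1 b) - pr 1 b * f (pr 1 a).
have : \sum_(p <- koszul 1 x y) beta p.1 p.2 = 0.
  apply: (@kd_zero_pairing k A A (fun u => u = 0) beta) kz => //.
  - by move=> u v -> ->; rewrite addr0.
  - move=> b c a a'; rewrite /beta !linearP /= mulrDl mulrDr -!scalerAl -!scalerAr.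
    by rewrite scalerBr opprD addrACA.
  - move=> a c b b'; rewrite /beta !linearP /= mulrDl mulrDr -!scalerAl -!scalerAr.
    by rewrite scalerBr opprD addrACA.
  - move=> a b c; rewrite /beta !prM !big_ord_recl !big_ord0 /= !addr0 !subnn !subn0.
    rewrite [bump _ _]/= !linearD /= ![pr 1 _ * pr 0 _]mulrC !fM //; ring.
rewrite !big_cons big_nil addr0 /beta /= !mul1r !linearN /= !pr_id // fx fy => E.
case/eqP: xN0; apply: (@is_ideal_natr k Hchar A (fun u => u = 0) 2) => //.
  by split=> // [u v -> ->|r u ->]; [apply: addr0 | apply: mulr0].
by rewrite -[RHS]E; ring.
Qed.

End GradedAlgebra.

(** * Leading coefficients along [phi] and the Euler pairing *)

Lemma hom_horner (k : fieldType) (A B : comFalgType k) (phi : A -> B) (c : A) (f : {poly k}) :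
  is_kalg_hom phi -> phi (horner_alg c f) = horner_alg (phi c) f.
Proof.
move=> [phiD phiM phi1 phiZ].
elim/poly_ind: f => [|f b IH].
  by rewrite !rmorph0; apply: (addrI (phi 0)); rewrite -phiD !addr0.
by rewrite !rmorphD !rmorphM /= !horner_algX !horner_algC phiD phiM IH phiZ phi1.
Qed.

Section LocalPairing.
Variables (k : fieldType) (A : comFalgType k) (n : nat) (Ad : nat -> {vspace A}).
Variable pr : nat -> 'End(A).
Hypotheses (sg : standard_graded n Ad) (prP : projections n Ad pr).
Variables (B : comFalgType k) (phi : 'Hom(A, B)).
Hypothesis phi_hom : is_kalg_hom phi.

(** Take [f(c) = 0] with [f'(c)] invertible in the field [Ad 0]: the chain rule gives
    [f'(c) dc = 0], carried to [B] by [phi]. *)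
Lemma null_dform_degree0 (Hchar : [pchar k] =i pred0) c :
  c \in Ad 0%N -> null_form (dform (phi c)).
Proof.
have [_ phiM phi1 _] := phi_hom.
have [[_ _ _ Ad1 AdM] _] := sg.
move=> c0; have [|||f [f0 f'0]] := @separable_mod k A Hchar (fun u => u = 0) c => //.
- by move=> a _ ->; rewrite scaler0.
- by move/eqP; rewrite oner_eq0.
have fc0 (g : {poly k}) : horner_alg c g \in Ad 0%N.
  elim/poly_ind: g => [|g b IH]; first by rewrite rmorph0 mem0v.
  rewrite rmorphD rmorphM /= horner_algX horner_algC memvD ?memvZ //.
  exact: (AdM 0%N 0%N).
have [b b0 bE] := graded0_inv sg prP (fc0 f^`()) (introN eqP f'0).
have h := null_dform_horner (phi c) f.
rewrite -!hom_horner // f0 linear0 in h.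
apply: null_form_ext (null_formD (null_formZ (phi b) (null_dform0 B))
  (null_formZ (- phi b) h)) => x.
transitivity (phi (b * horner_alg c f^`()) * dform (phi c) x); first by rewrite phiM; ring.
by rewrite bE phi1 mul1r.
Qed.

Variables (t : B) (e d : nat) (D : 'End(B)) (J : B -> Prop).
Hypotheses (loc : local_at t) (e0 : (0 < e)%N).
Hypothesis emin : forall m, (m < e)%N -> ~ exists r, t ^+ m = r * t ^+ m.+1.
Hypotheses (idJ : is_ideal J) (Jt : J (t ^+ e.-1)).
Hypothesis leibD : forall x y, J (D (x * y) - x * D y - y * D x).
Hypothesis D0 : forall c, c \in Ad 0%N -> J (D (phi c)).
Hypothesis phi1 : forall y, y \in Ad 1%N -> exists r, phi y = r * t ^+ d.

Lemma D_exp m : exists r, J (D (t ^+ m.+1) - r * t ^+ m).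
Proof.
have [J0 JD JM] := idJ.
elim: m => [|m [r IH]]; first by exists (D t); rewrite expr0 expr1 mulr1 subrr.
exists (r + D t).
have -> : D (t ^+ m.+2) - (r + D t) * t ^+ m.+1 =
    (D (t * t ^+ m.+1) - t * D (t ^+ m.+1) - t ^+ m.+1 * D t) +
    t * (D (t ^+ m.+1) - r * t ^+ m).
  by rewrite (exprS t m.+1); move: (D (t * _)) (D (t ^+ _)) => u v; rewrite exprS; ring.
by apply: JD; [apply: leibD | apply: JM].
Qed.

(** Leibniz on [x * t ^+ m = 0] reduces the claim to [x * D (t ^+ m)]. Here [x] is a multiple of
    [t ^+ (e - m)] and [D (t ^+ m)] of [t ^+ m.-1] modulo [J], and [t ^+ e.-1] is in [J]. *)
Lemma D_annihilated x m : (m < e)%N -> x * t ^+ m = 0 -> J (D x * t ^+ m).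
Proof.
have [J0 JD JM] := idJ.
case: m => [|m] lt_me xt; first by rewrite -[x]mulr1 xt linear0 mul0r.
have [s xE] : exists s, x = s * t ^+ (e - m.+1).
  by apply: (@local_cancel _ t loc e m.+1 _ x 0) => //; [lia | rewrite xt mul0r].
have [r Dr] := D_exp m.
have -> : D x * t ^+ m.+1 = (x * (D (t ^+ m.+1) - r * t ^+ m) + r * (x * t ^+ m)) * (-1)
   - (D (x * t ^+ m.+1) - x * D (t ^+ m.+1) - t ^+ m.+1 * D x).
  by rewrite xt linear0; ring.
apply: (is_idealB idJ) (leibD _ _); rewrite mulrC; apply/(JM)/JD; apply/(JM) => //.
have em : (e - m.+1 + m = e.-1)%N by lia.
by rewrite xE -mulrA -exprD em; apply: JM.
Qed.

(** Positive degrees are spanned by products with a degree-one factor, and each such factor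
    contributes [t ^+ d]. *)
Lemma phi_order i a : a \in Ad i -> exists r, phi a = r * t ^+ (i * d).
Proof.
have [pr_mem pr_id _ _] := prP; have [_ phiM _ _] := phi_hom.
elim: i a => [|i IH] a ai; first by exists (phi a); rewrite expr0 mulr1.
have sub : (fullv * Ad 1%N <= (phi \o pr i.+1)%VF @^-1: limg (amulr (t ^+ (i.+1 * d))%R))%VS.
  apply/prodvP => u v _ v1; rewrite -memv_preim lfunE /= (prS_mul1 sg prP) // phiM.
  have [r ->] := IH _ (pr_mem i u); have [s ->] := phi1 v1.
  apply/memv_imgP; exists (r * s); rewrite ?memvf // lfunE /= mulSn exprD; ring.
have := subvP sub _ (pr_genS sg prP i a).
rewrite -memv_preim lfunE /= !(pr_id _ _ ai) => /memv_imgP[r _ ->].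
by exists r; rewrite lfunE.
Qed.

(* [phi a / t ^ (i * d)], meaningful for [a] in [Ad i]. *)
Definition leading i : 'Hom(A, B) := ((amulr (t ^+ (i * d))%R)^-1 \o phi)%VF.

Lemma leadingE i a : a \in Ad i -> leading i a * t ^+ (i * d) = phi a.
Proof.
move=> /phi_order[r E].
have := @limg_lfunVK _ _ _ (amulr (t ^+ (i * d))) (phi a).
rewrite lfunE /= => E'; rewrite /leading comp_lfunE E' //.
by apply/memv_imgP; exists r; rewrite ?memvf // lfunE; apply: E.
Qed.

Variable p : nat.
Hypothesis lt_pd : (p * d < e)%N.

Definition Jcolon x := J (x * t ^+ (p * d)).

Lemma Jcolon_ideal : is_ideal Jcolon.
Proof.
have [J0 JD JM] := idJ; rewrite /Jcolon; split.
- by rewrite mul0r.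
- by move=> x y Jx Jy; rewrite mulrDl; apply: JD.
- by move=> r x Jx; rewrite -mulrA; apply: JM.
Qed.

Lemma Jcolon_sub x : J x -> Jcolon x.
Proof. by move=> Jx; rewrite /Jcolon mulrC; have [_ _ JM] := idJ; apply: JM. Qed.

(** [leading] chooses some quotient by the power of [t], so it is multiplicative only up to what
    that power kills. *)
Lemma leadingM_annihilated i j a b : a \in Ad i -> b \in Ad j ->
  (leading (i + j) (a * b) - leading i a * leading j b) * t ^+ ((i + j) * d) = 0.
Proof.
have [[_ _ _ _ AdM] _] := sg; have [_ phiM _ _] := phi_hom.
move=> ai bj; rewrite mulrBl leadingE ?AdM // mulnDl exprD mulrACA !leadingE // phiM.
exact: subrr.
Qed.

Lemma leadingM i j a b : a \in Ad i -> b \in Ad j -> (i + j <= p)%N ->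
  Jcolon (leading (i + j) (a * b) - leading i a * leading j b).
Proof.
move=> ai bj le_ijp; rewrite /Jcolon -(subnKC le_ijp) mulnDl exprD mulrA.
by rewrite leadingM_annihilated // mul0r; have [] := idJ.
Qed.

(** The defect of multiplicativity is killed by [t ^+ (p * d)]; as [p * d < e], so is its image
    under [D], modulo [J]. *)
Lemma D_leadingM i j a b : a \in Ad i -> b \in Ad j -> (i + j <= p)%N ->
  Jcolon (D (leading (i + j) (a * b)) - leading i a * D (leading j b) -
    leading j b * D (leading i a)).
Proof.
move=> ai bj le_ijp.
set u := leading _ (a * b); set v := leading _ a; set w := leading _ b.
have -> : D u - v * D w - w * D v = D (u - v * w) + (D (v * w) - v * D w - w * D v).
  by rewrite linearB /=; ring.
have [_ QD _] := Jcolon_ideal; apply: QD; last exact/Jcolon_sub/leibD.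
apply: D_annihilated => //; rewrite -(subnKC le_ijp) mulnDl exprD mulrA.
by rewrite leadingM_annihilated // mul0r.
Qed.

Lemma D_leading0 c : c \in Ad 0%N -> Jcolon (D (leading 0 c)).
Proof.
move=> c0; have := leadingE c0; rewrite mul0n expr0 mulr1 => ->.
exact/Jcolon_sub/D0.
Qed.

(* [E u * D v - E v * D u] with [E] the Euler derivation: the powers of [t] split
   off by [leading] cancel in it. *)
Definition euler_term i j a b : B :=
  i%:R * leading i a * D (leading j b) - j%:R * leading j b * D (leading i a).

(** Total degree [p.+1], both degrees between [1] and [p], the range where [leading] obeys the
    product rules modulo [Jcolon]. The omitted extreme terms would be multiples of [D] of a
    degree-zero leading coefficient. *)
Definition euler_pairing a b : B :=
  \sum_(i < p) euler_term i.+1 (p - i) (pr i.+1 a) (pr (p - i)%N b).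

Lemma euler_pairing_linl b : linear (euler_pairing^~ b).
Proof.
move=> c a a'; rewrite /euler_pairing scaler_sumr -big_split; apply: eq_bigr => i _ /=.
rewrite /euler_term (linearP (pr _)) (linearP (leading _)) (linearP D).
have [g gE] : exists g : B, forall z, c *: z = g * z by exists c%:A => z; rewrite mulr_algl.
by rewrite /= !gE; ring.
Qed.

Lemma euler_pairing_linr a : linear (euler_pairing a).
Proof.
move=> c b b'; rewrite /euler_pairing scaler_sumr -big_split; apply: eq_bigr => i _ /=.
rewrite /euler_term (linearP (pr _)) (linearP (leading _)) (linearP D).
have [g gE] : exists g : B, forall z, c *: z = g * z by exists c%:A => z; rewrite mulr_algl.
by rewrite /= !gE; ring.
Qed.

Lemma euler_term0l i j b : euler_term i j 0 b = 0.
Proof. by rewrite /euler_term (linear0 (leading _)) (linear0 D); ring. Qed.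

Lemma euler_term0r i j a : euler_term i j a 0 = 0.
Proof. by rewrite /euler_term (linear0 (leading _)) (linear0 D); ring. Qed.

Lemma euler_pairing_hom i j a b : a \in Ad i -> b \in Ad j ->
  euler_pairing a b = if ((0 < i <= p) && (i + j == p.+1))%N then euler_term i j a b else 0.
Proof.
clear e0 lt_pd; have [_ pr_id pr_ne _] := prP; move=> ai bj; rewrite /euler_pairing.
case: ifP => [/andP[/andP[i0 le_ip] /eqP ijp]|no].
  have lt_ip : (i.-1 < p)%N by lia.
  rewrite (bigD1 (Ordinal lt_ip)) //= big1 ?addr0.
    have -> : (p - i.-1 = j)%N by lia.
    by rewrite prednK // !pr_id.
  move=> l li; rewrite (pr_ne _ i) ?euler_term0l //.
  by apply: contra_neq li => E; apply: val_inj => /=; rewrite -E.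
apply: big1 => l _; have lt_lp := ltn_ord l.
have [li|li] := eqVneq l.+1 i; last by rewrite (pr_ne _ i) ?euler_term0l.
rewrite (pr_ne (p - l)%N j) ?euler_term0r //; apply: contraFneq no => lj.
by rewrite -li -lj; lia.
Qed.

(** If all three degrees are positive, every product has degree at most [p], and the product rules
    for [leading] and [D] give the identity. If [a] or [b] has degree zero, a pairing drops out and
    what is left over is a multiple of [D] of a degree-zero leading coefficient. *)
Lemma euler_pairing_leibniz_hom i j l a b c :
  a \in Ad i -> b \in Ad j -> c \in Ad l ->
  Jcolon (euler_pairing a (b * c) - euler_pairing (a * b) c - euler_pairing (a * c) b).
Proof.
have [[_ _ _ _ AdM] _] := sg; have idQ := Jcolon_ideal; have [Q0 QD QM] := idQ.
wlog le_jl : j l b c / (j <= l)%N.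
  move=> H ai bj cl; case: (leqP j l) => [le_jl|/ltnW le_lj]; first exact: H le_jl ai bj cl.
  by rewrite [b * c]mulrC addrAC; apply: H le_lj ai cl bj.
move=> ai bj cl.
rewrite (euler_pairing_hom ai (AdM _ _ _ _ bj cl)).
rewrite (euler_pairing_hom (AdM _ _ _ _ ai bj) cl).
rewrite (euler_pairing_hom (AdM _ _ _ _ ai cl) bj).
have [ijl|ijl] := eqVneq (i + j + l)%N p.+1; last first.
  rewrite !ifF ?subr0 //; lia.
have [i0|i0] := posnP i; first subst i.
  rewrite /= sub0r !add0n.
  case: (boolP (0 < j <= p)%N) => [/andP[j0 le_jp]|nj]; last by rewrite !ifF ?subr0 ?oppr0 //; lia.
  rewrite /= ifT; last by lia.
  rewrite /euler_term.
  have Eb := leadingM ai bj le_jp; have Gb := D_leadingM ai bj le_jp.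
  have le_lp : (l <= p)%N by lia.
  have Ec := leadingM ai cl le_lp; have Gc := D_leadingM ai cl le_lp.
  have Da := D_leading0 ai.
  move: Eb Gb Ec Gc Da; rewrite !add0n.
  move: (leading j (a * b)) (leading l (a * c)) => u v.
  move: (leading 0 a) (leading j b) (leading l c) => x y z.
  move: (D u) (D v) (D x) (D y) (D z) => du dv dx dy dz Eb Gb Ec Gc Da.
  have -> : - (j%:R * u * dz - l%:R * z * du) - (l%:R * v * dy - j%:R * y * dv) =
      - (j%:R * dz) * (u - x * y) + l%:R * z * (du - x * dy - y * dx)
      + (- (l%:R * dy) * (v - x * z) + j%:R * y * (dv - x * dz - z * dx))
      + (l + j)%:R * y * z * dx by ring.
  by do ![assumption | apply/QD | apply/QM].
have [j0|j0] := posnP j; first subst j.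
  rewrite [X in Jcolon (_ - X)]ifF ?subr0; last by lia.
  case: (boolP (0 < i <= p)%N) => [/andP[_ le_ip]|ni]; last by rewrite !ifF ?subr0 //; lia.
  rewrite add0n addn0 i0 le_ip /= ifT; last by lia.
  rewrite /euler_term.
  have Ebc := leadingM bj cl (_ : (0 + l <= p)%N); have Gbc := D_leadingM bj cl (_ : (0 + l <= p)%N).
  have Eab := leadingM ai bj (_ : (i + 0 <= p)%N); have Gab := D_leadingM ai bj (_ : (i + 0 <= p)%N).
  have Db := D_leading0 bj.
  have le_lp : (l <= p)%N by lia.
  move: Ebc Gbc Eab Gab Db; rewrite !addn0 !add0n => /(_ le_lp) + /(_ le_lp) + /(_ le_ip) + /(_ le_ip).
  move: (leading l (b * c)) (leading i (a * b)) => u v.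
  move: (leading i a) (leading 0 b) (leading l c) => x y z.
  move: (D u) (D v) (D x) (D y) (D z) => du dv dx dy dz Ebc Gbc Eab Gab Db.
  have -> : i%:R * x * du - l%:R * u * dx - (i%:R * v * dz - l%:R * z * dv) =
      i%:R * x * (du - y * dz - z * dy) - l%:R * dx * (u - y * z)
      + (- (i%:R * dz) * (v - x * y) + l%:R * z * (dv - x * dy - y * dx))
      + (i + l)%:R * x * z * dy by ring.
  by do ![assumption | apply/(is_idealB idQ) | apply/QD | apply/QM].
have [le_jlp le_ijp le_ilp] : [/\ (j + l <= p)%N, (i + j <= p)%N & (i + l <= p)%N].
  by split; lia.
rewrite !ifT; try lia.
rewrite /euler_term.
have Ebc := leadingM bj cl le_jlp; have Gbc := D_leadingM bj cl le_jlp.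
have Eab := leadingM ai bj le_ijp; have Gab := D_leadingM ai bj le_ijp.
have Eac := leadingM ai cl le_ilp; have Gac := D_leadingM ai cl le_ilp.
move: Ebc Gbc Eab Gab Eac Gac.
move: (leading _ (b * c)) (leading _ (a * b)) (leading _ (a * c)) => u v w.
move: (leading i a) (leading j b) (leading l c) => x y z.
move: (D u) (D v) (D w) (D x) (D y) (D z) => du dv dw dx dy dz Ebc Gbc Eab Gab Eac Gac.
have -> : i%:R * x * du - (j + l)%:R * u * dx - ((i + j)%:R * v * dz - l%:R * z * dv)
      - ((i + l)%:R * w * dy - j%:R * y * dw) =
    i%:R * x * (du - y * dz - z * dy) - (j + l)%:R * dx * (u - y * z)
    + (- ((i + j)%:R * dz) * (v - x * y) + l%:R * z * (dv - x * dy - y * dx))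
    + (- ((i + l)%:R * dy) * (w - x * z) + j%:R * y * (dw - x * dz - z * dx)) by ring.
by do ![assumption | apply/(is_idealB idQ) | apply/QD | apply/QM].
Qed.

Lemma euler_pairing_leibniz a b c :
  Jcolon (euler_pairing a (b * c) - euler_pairing (a * b) c - euler_pairing (a * c) b).
Proof.
have idQ := Jcolon_ideal; have [Q0 QD QM] := idQ.
have lD b' x y : euler_pairing (x + y) b' = euler_pairing x b' + euler_pairing y b'.
  by have := euler_pairing_linl b' 1 x y; rewrite !scale1r.
have rD x b' y : euler_pairing x (b' + y) = euler_pairing x b' + euler_pairing x y.
  by have := euler_pairing_linr x 1 b' y; rewrite !scale1r.
have l0 b' : euler_pairing 0 b' = 0 by apply: (addrI (euler_pairing 0 b')); rewrite -lD !addr0.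
have r0 x : euler_pairing x 0 = 0 by apply: (addrI (euler_pairing x 0)); rewrite -rD !addr0.
elim/(homogeneous_ind prP): a => [|x y hx hy|i a ai].
- by rewrite !mul0r !l0 !subr0.
- by rewrite !mulrDl !lD; have := QD _ _ hx hy; congr Jcolon; ring.
elim/(homogeneous_ind prP): b => [|x y hx hy|j b bj].
- by rewrite mul0r mulr0 !l0 !r0 !subr0.
- by rewrite !mulrDl !mulrDr !rD !lD; have := QD _ _ hx hy; congr Jcolon; ring.
elim/(homogeneous_ind prP): c => [|x y hx hy|l c cl].
- by rewrite !mulr0 !l0 !r0 !subr0.
- by rewrite !mulrDr !rD !lD; have := QD _ _ hx hy; congr Jcolon; ring.
exact: euler_pairing_leibniz_hom ai bj cl.
Qed.

(** The difference from [leading 1 z ^+ m] is killed by [t ^+ (m * d)], hence divisible by [t]. *)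
Lemma leading_unit_exp z m : z \in Ad 1%N -> unit_mod t (leading 1 z) -> (m * d < e)%N ->
  unit_mod t (leading m (z ^+ m)).
Proof.
have [_ phiM phi_1 _] := phi_hom.
move=> z1 uz lt_md; have zm := graded_exp sg m z1.
have phiX : phi (z ^+ m) = phi z ^+ m.
  by elim: m {lt_md zm} => [|m IH]; rewrite ?expr0 // !exprS phiM IH.
have [||s sE] := @local_cancel _ t loc e (m * d) 1 (leading m (z ^+ m) - leading 1 z ^+ m) 0 emin.
- by rewrite addn1.
- rewrite mulrBl (leadingE zm) phiX -(leadingE z1) mul1n exprMn -exprM [(d * m)%N]mulnC.
  by rewrite subrr mul0r.
have [r [r' E]] := unit_mod_exp m uz; exists (r - r' * s), r'.
rewrite expr1 in sE; have -> : leading m (z ^+ m) = s * t + leading 1 z ^+ m.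
  by rewrite -sE subrK.
by rewrite [LHS]E; ring.
Qed.

(** Modulo [Jcolon] the Euler pairing sends the form to [p.+1] times [q = leading m.+1 (z ^+ m.+1)]
    times the target, the [D q] terms cancelling. Both factors can be removed: [q] is invertible
    modulo [t], and [Jcolon] contains [t ^+ e]. *)
Lemma koszul_leading (Hchar : [pchar k] =i pred0) m x y z :
    p = m.+2 -> x \in Ad 1%N -> y \in Ad 1%N -> z \in Ad 1%N ->
    unit_mod t (leading 1 z) -> kd_zero (koszul (z ^+ m.+1) x y) ->
  Jcolon (leading 1 x * D (leading 1 y) - leading 1 y * D (leading 1 x)).
Proof.
move=> pE x1 y1 z1 uz kz.
have [[_ _ _ _ AdM] _] := sg; have idQ := Jcolon_ideal; have [Q0 QD QM] := idQ.
have zm := graded_exp sg m.+1 z1.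
have le_p : (m.+1 + 1 <= p)%N by rewrite pE addn1.
have zp u : u \in Ad 1%N -> z ^+ m.+1 * u \in Ad p.
  by move=> u1; have := AdM _ _ _ _ zm u1; rewrite addn1 pE.
have := kd_zero_pairing Q0 QD euler_pairing_linl euler_pairing_linr euler_pairing_leibniz kz.
rewrite !big_cons big_nil addr0 /= !(@euler_pairing_hom p 1) ?memvN ?zp //.
rewrite addn1 leqnn eqxx pE andbT /= -pE /euler_term (linearN (leading p)) (linearN D) /=.
have Ex := leadingM zm x1 le_p; have Gx := D_leadingM zm x1 le_p.
have Ey := leadingM zm y1 le_p; have Gy := D_leadingM zm y1 le_p.
have uzm : unit_mod t (leading m.+1 (z ^+ m.+1)).
  apply: leading_unit_exp => //; apply: leq_ltn_trans lt_pd; rewrite pE mulSn.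
  exact: leq_addl.
rewrite addn1 -pE in Ex Gx Ey Gy; move: Ex Gx Ey Gy uzm.
move: (leading p (z ^+ m.+1 * x)) (leading p (z ^+ m.+1 * y)) => u v.
move: (leading 1 x) (leading 1 y) (leading m.+1 _) => qx qy q.
move: (D u) (D v) (D qx) (D qy) (D q) => du dv dx dy dq Ex Gx Ey Gy uq W.
have Qt : Jcolon (t ^+ e).
  by apply: Jcolon_sub; rewrite -(prednK e0) exprS; have [_ _ JM] := idJ; apply: JM.
apply: (unit_mod_cancel idQ Qt uq); apply: (is_ideal_natr Hchar idQ (ltn0Sn p)).
move: W; set w := (X in Jcolon X) => W.
have -> : p.+1%:R * (q * (qx * dy - qy * dx)) =
    w + (- (p%:R * dy) * (u - q * qx) + qy * (du - q * dx - qx * dq)) +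
    (p%:R * dx * (v - q * qy) + - qx * (dv - q * dy - qy * dq)) by rewrite /w; ring.
by do ![assumption | apply/QD | apply/QM].
Qed.

End LocalPairing.

(** * Raising the degree, and the conclusion *)

(** The given form has degree [i.+2], taken as [p]; the Euler pairing then sees degree [p.+1], that
    of [koszul (z ^+ i.+1) x y]. *)
Lemma koszul_step (k : fieldType) (Hchar : [pchar k] =i pred0) (A : comFalgType k)
    (n : nat) (Ad : nat -> {vspace A}) (pr : nat -> 'End(A)) (i : nat) (a x y : A)
    (B : comFalgType k) (phi : A -> B) :
  standard_graded n Ad -> projections n Ad pr ->
  a \in Ad i -> x \in Ad 1%N -> y \in Ad 1%N ->
  principal_ideal_algebra B -> is_kalg_hom phi ->
  ~ kd_zero (kd_map phi (koszul a x y)) ->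
  exists2 z, z \in Ad 1%N & ~ kd_zero (koszul (z ^+ i.+1) x y).
Proof.
move=> sg prP ai x1 y1 pia phi_hom.
have [phiD phiM phi1 phiZ] := phi_hom.
have [F FE] : exists F : 'Hom(A, B), forall u, F u = phi u.
  by apply: lfun_of_linear => c u v; rewrite phiD phiZ.
have F_hom : is_kalg_hom F.
  by split=> *; rewrite !FE.
move=> /(local_differential Hchar pia)[t [e [D [J [[loc e0 emin] [idJ Jt leibD nullD]]]]]].
have [J0 JD JM] := idJ.
rewrite /kd_map /koszul /= !big_cons big_nil addr0 /= -!FE linearN /=.
have FM u v : F (u * v) = F u * F v by rewrite !FE.
rewrite !FM => nJ.
have Je : J (t ^+ e) by rewrite -(prednK e0) exprS; apply: JM.
(* [d] is the least order of [F] on degree one. It is below [e]: otherwise [F x] and [F y] are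
   multiples of [t ^+ e], which lies in [J], against [nJ]. *)
have [d [[z z1 zN] dmin]] : exists d, (exists2 z, z \in Ad 1%N & ~ exists r, F z = r * t ^+ d.+1) /\
    forall m, (m < d)%N -> ~ exists2 z, z \in Ad 1%N & ~ exists r, F z = r * t ^+ m.+1.
  apply: ex_least; exists e.-1; apply: NNPP => no; apply: nJ.
  have F1 u : u \in Ad 1%N -> exists r, F u = r * t ^+ e.
    move=> u1; apply: NNPP => h; apply: no; exists u => //; by rewrite prednK.
  have [r ->] := F1 x x1; have [s ->] := F1 y y1.
  have -> : F a * (r * t ^+ e) * D (s * t ^+ e) + - (F a * (s * t ^+ e)) * D (r * t ^+ e) =
     (F a * r * D (s * t ^+ e) - F a * s * D (r * t ^+ e)) * t ^+ e.
    by move: (D _) (D _) => u v; ring.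
  exact: JM.
have F1 u : u \in Ad 1%N -> exists r, F u = r * t ^+ d.
  case: d {z z1 zN} dmin => [|d] dmin u1; first by exists (F u); rewrite expr0 mulr1.
  by apply: NNPP => h; apply: (dmin d) => //; exists u.
pose q := leading F t d.
have qE j u : u \in Ad j -> q j u * t ^+ (j * d) = F u.
  exact: (leadingE sg prP F_hom F1).
pose Q := Jcolon t d J i.+2.
pose b := q 1%N x * D (q 1%N y) - q 1%N y * D (q 1%N x).
(* The terms in [D (t ^+ d)] cancel, so the image of the form has coefficient
   [q i a * b * t ^+ (i.+2 * d)] modulo [J]. *)
have nQ : ~ Q b.
  rewrite /Q /Jcolon => h; apply: nJ.
  rewrite -(qE _ _ x1) -(qE _ _ y1) -(qE _ _ ai) mul1n.
  have hx := leibD (q 1%N x) (t ^+ d); have hy := leibD (q 1%N y) (t ^+ d).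
  have idE : t ^+ (i.+2 * d) = t ^+ (i * d) * t ^+ d * t ^+ d.
    by rewrite -!exprD; congr (_ ^+ _); lia.
  rewrite idE {}/b in h.
  move: hx hy h; move: (q 1%N x) (q 1%N y) (q i a) => qx qy qa.
  move: (D (qx * _)) (D (qy * _)) (D (t ^+ d)) (D qx) (D qy) => u v w dx dy hx hy h.
  have -> : qa * t ^+ (i * d) * (qx * t ^+ d) * v + - (qa * t ^+ (i * d) * (qy * t ^+ d)) * u =
      qa * t ^+ (i * d) * t ^+ d * qx * (v - qy * w - t ^+ d * dy) +
      - (qa * t ^+ (i * d) * t ^+ d * qy) * (u - qx * w - t ^+ d * dx) +
      qa * ((qx * dy - qy * dx) * (t ^+ (i * d) * t ^+ d * t ^+ d)) by ring.
  by do ![assumption | apply/JD | apply/JM].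
have lt_pd : (i.+2 * d < e)%N.
  rewrite ltnNge; apply/negP => le_e; apply: nQ; rewrite /Q /Jcolon -(subnK le_e) exprD mulrA.
  exact: JM.
have D0 c : c \in Ad 0%N -> J (D (F c)).
  move=> c0; rewrite -[D _]mul1r; apply: nullD.
  apply: null_form_ext (null_dform_degree0 sg prP F_hom Hchar c0) => u.
  by rewrite mul1r.
exists z => // kz; apply: nQ.
apply: (koszul_leading sg prP F_hom loc e0 emin idJ Jt leibD D0 F1 lt_pd Hchar erefl x1 y1 z1 _ kz).
(* Were [q 1 z] divisible by [t], the order of [F z] would exceed [d]. *)
case: (loc (q 1%N z)) => // -[r E]; case: zN; exists r.
by rewrite -(qE _ _ z1) E mul1n exprS mulrA.
Qed.

Theorem theorem2p1 (k : fieldType) (Hchar : [pchar k] =i pred0)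
  (A : comFalgType k) (n : nat) (Ad : nat -> {vspace A}) :
  @standard_graded k A n Ad -> ~ @principal_ideal_algebra k A -> @tau_nonzero k A.
Proof.
move=> sg npia; have [pr prP] := graded_projections sg.
have [[Adn _ _ Ad1 _] _] := sg.
have [x [y [x1 y1 xyN0]]] := koszul_neq0 sg prP Hchar npia.
(* Induction on the room [m] left above degree [i]: past degree [n] the form vanishes; before that,
   either every [phi] kills it or [koszul_step] yields a non-zero form one degree higher. *)
have lift m i a : (n < i + m)%N -> a \in Ad i -> ~ kd_zero (koszul a x y) -> tau_nonzero A.
  elim: m i a => [|m IH] i a lt_n ai aN0.
    case: aN0; rewrite addn0 in lt_n; move: ai; rewrite Adn // memv0 => /eqP ->.
    apply: null_form_ext (null_form0 A) => b.
    by rewrite kd_coefE !big_cons big_nil /= !mul0r oppr0 !mul0r !addr0.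
  apply: NNPP => notau; apply: (notau); exists (koszul a x y); split=> // B phi pia phi_hom.
  apply: NNPP => wN0; apply: notau.
  have [z z1 zN] := koszul_step Hchar sg prP ai x1 y1 pia phi_hom wN0.
  by apply: (IH i.+1 (z ^+ i.+1)) => //; [rewrite addSn -addnS | apply: (graded_exp sg)].
exact: (lift n.+1 0%N 1).
Qed.
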